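(* Let $g$ be a positive integer. There exists a $\mathrm{GDD}(4,5,7g+4g)$ of type $g^{7}(4g)^1$ if and only if $g$ is even.
   Context: A group divisible design $\mathrm{GDD}(t,k,m)$ of type $g_1^{n_1} g_2^{n_2}\cdots g_r^{n_r}$, where $t \ge 2$ and $m=\sum_{i=1}^r n_i g_i$, is a triple $(X,G,B)$ such that $X$ is a set of $m$ points; $G$ is a partition of $X$ into $n=\sum_{i=1}^r n_i$ groups, of which $n_i$ have exactly $g_i$ points, $1\le i\le r$; $B$ is a set of $k$-subsets of $X$ (blocks); each block contains at most one point from each group; and each $t$-subset of $X$ which contains at most one point from each group is contained in exactly one block of $B$. *)

(* Defs.v *)
From mathcomp Require Import all_boot.

Set Implicit Arguments.
Unset Strict Implicit.
Unset Printing Implicit Defensive.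

Definition transversal_to (X : finType) (G : {set {set X}}) (S : {set X}) : Prop :=
  forall A : {set X}, A \in G -> #|S :&: A| <= 1.

(* The type g_1^n_1 ... g_r^n_r is the list [:: (g_1, n_1); ...; (g_r, n_r)].
   X is the whole carrier.  [gdd_type] equates the multiset of group sizes with
   that of the type; it forces #|G| = n_1 + ... + n_r, and is meaningful even
   if some g_i are repeated. *)
Record is_GDD (t k m : nat) (ty : seq (nat * nat))
    (X : finType) (G B : {set {set X}}) : Prop := IsGDD {
  gdd_strength : 2 <= t;
  gdd_order : m = \sum_(p <- ty) p.2 * p.1;
  gdd_points : #|X| = m;
  gdd_partition : partition G [set: X];
  gdd_type : perm_eq [seq #|A : {set X}| | A <- enum G]
                     (flatten [seq nseq p.2 p.1 | p <- ty]);
  gdd_block_size : forall b : {set X}, b \in B -> #|b| = k;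
  gdd_block_transversal : forall b : {set X}, b \in B -> transversal_to G b;
  gdd_cover : forall S : {set X}, #|S| = t -> transversal_to G S ->
    exists! b : {set X}, b \in B /\ S \subset b
}.

Definition GDD_exists (t k m : nat) (ty : seq (nat * nat)) : Prop :=
  exists (X : finType) (G B : {set {set X}}), is_GDD t k m ty G B.

(* Main.v *)
Require Import Defs.
From mathcomp Require Import all_boot.
From mathcomp Require Import all_algebra zify.

Set Implicit Arguments.
Unset Strict Implicit.
Unset Printing Implicit Defensive.

Import GRing.Theory.

(** Necessity is a counting argument.  Fix a point in the group of size 4g and
    one point in each of two other groups.  Every point of the five remaining
    groups lies in a unique block through these three points, and such a block
    has exactly two further points, so the 5g remaining points are split into
    pairs and g is even ([gdd_dvdn], [GDD_7_1_even]).

    For sufficiency it is enough to treat g = 2.  In a design whose block size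
    exceeds its strength by one, each point can be replaced by h copies, each
    block then giving rise to the h^t sections over it whose levels add up to 0
    in Z_h: the levels of t points force the level of the last one
    ([GDD_weighting]).  This turns type 2^7 8^1 into (2h)^7 (8h)^1.

    For type 2^7 8^1, counting shows that the 560 quadruples meeting four of the
    seven small groups must all be extended by points of the large group.  The
    design is thus a partition of these quadruples into eight parts, indexed by
    the points of the large group, each covering every transversal triple of
    small groups exactly once.  The seven small groups are identified with the
    points of the Fano plane.  The simplex code of length 7, whose nonzero words
    are the complements of the lines, acts by exchanging the two points of each
    group in the support of a word, and it acts regularly on the eight parts by
    translation.  Together with the rotation of Z_7 it generates a group of
    order 56, for which ten orbit representatives suffice ([blocks22]).  They
    are the outcome of an exact cover search, and the cover property of the 560
    blocks is established by evaluation ([GDD_2_7_8_1]), through a criterion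
    that prunes the list of blocks point by point ([each_once]). *)

(** * Transversals and a divisibility condition *)

Lemma transversalP (X : finType) (G : {set {set X}}) (S : {set X}) :
  partition G [set: X] ->
  transversal_to G S <-> {in S &, injective (pblock G)}.
Proof.
case/and3P=> /eqP covG trG _; have inG x : x \in cover G by rewrite covG inE.
split=> [trS x y Sx Sy eqG | injS A GA].
  have := trS _ (pblock_mem (inG x)) => /card_le1_eqP.
  apply; rewrite !inE ?Sx ?Sy ?mem_pblock ?inG //=.
  by rewrite eqG mem_pblock inG.
apply/card_le1_eqP=> x y; rewrite !inE => /andP[Sx Ax] /andP[Sy Ay].
by apply: injS => //; rewrite !(def_pblock trG GA).
Qed.

(** Sort the points outside the groups of [S] by the unique block that contains
    them together with [S].  All points of a block outside [S] are outside the
    groups of [S], so each block through [S] collects [k - #|S|] of them. *)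
Lemma gdd_dvdn t k m ty (X : finType) (G B : {set {set X}}) (S : {set X}) :
    is_GDD t k m ty G B -> transversal_to G S -> #|S|.+1 = t ->
  k - #|S| %| #|[set y | pblock G y \notin pblock G @: S]|.
Proof.
case=> _ _ _ partG _ sizeB trB cov trS cardS.
set Y := [set y | _].
have notS y : y \in Y -> y \notin S.
  by rewrite inE; apply: contra => Sy; apply: imset_f.
have -> : #|Y| = \sum_(y in Y) \sum_(b in B | y |: S \subset b) 1.
  rewrite -sum1_card; apply: eq_bigr => y Yy.
  have trY : transversal_to G (y |: S).
    move/(transversalP _ partG): trS => injS; apply/(transversalP _ partG).
    have neqY z : z \in S -> pblock G z <> pblock G y.
      by move=> Sz eqG; move: Yy; rewrite inE -eqG imset_f.
    move=> u v; rewrite !inE => /predU1P[->|Su] /predU1P[->|Sv] //.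
    - by move/esym/(neqY _ Sv).
    - by move/(neqY _ Su).
    - exact: injS.
  have cY : #|y |: S| = t by rewrite cardsU1 notS.
  have [b [[Bb Sb] uniqb]] := cov _ cY trY.
  rewrite (big_pred1 b) // => b'; apply/andP/eqP=> [[Bb' Sb'] | -> //].
  by rewrite (uniqb b').
rewrite (exchange_big_dep (fun b => (b \in B) && (S \subset b))) /=; last first.
  by move=> y b _ /andP[-> /subUsetP[]].
apply: dvdn_sum => b /andP[Bb Sb].
rewrite sum1_card Bb /=.
suff -> : #|[pred y | (y \in Y) && (y |: S \subset b)]| = #|b :\: S|.
  by rewrite cardsD (setIidPr Sb) (sizeB _ Bb).
apply: eq_card => y; rewrite !inE subUset sub1set Sb andbT.
case: (boolP (y \in b)) => by_; rewrite ?andbF ?andbT //.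
have /(transversalP _ partG) injb := trB _ Bb.
apply/idP/idP => [Yy|Sy]; first by apply: notS; rewrite inE.
apply/imsetP => -[x Sx eqG]; move: Sy; rewrite (injb y x) ?Sx //.
exact: (subsetP Sb).
Qed.

(** * Inflating the points of a design *)

Section Inflation.
Variables (X Y : finType).
Implicit Types (G : {set {set X}}) (A : {set X}).

Definition inflate A : {set X * Y} := fst @^-1: A.

Lemma card_inflate A : #|inflate A| = #|Y| * #|A|.
Proof.
suff -> : inflate A = setX A [set: Y] by rewrite cardsX cardsT mulnC.
by apply/setP=> -[x y]; rewrite !inE andbT.
Qed.

Lemma inflate_inj (y0 : Y) : injective inflate.
Proof.
by move=> A1 A2 /setP eqA; apply/setP=> x; have := eqA (x, y0); rewrite !inE.
Qed.

Lemma partition_inflate G (y0 : Y) :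
  partition G [set: X] -> partition (inflate @: G) [set: X * Y].
Proof.
case/and3P=> /eqP covG trG G0.
have inG x : x \in cover G by rewrite covG inE.
apply/and3P; split.
- rewrite eqEsubset subsetT; apply/subsetP=> -[x y] _.
  apply/bigcupP; exists (inflate (pblock G x)).
    by apply/imset_f/pblock_mem.
  by rewrite inE mem_pblock.
- apply/trivIsetP=> _ _ /imsetP[A1 G1 ->] /imsetP[A2 G2 ->] neqA.
  have {neqA} : A1 != A2 by apply: contraNneq neqA => ->.
  move/(trivIsetP trG _ _ G1 G2) => dis.
  rewrite -setI_eq0; apply/eqP/setP=> -[x y]; rewrite !inE.
  by apply/negP=> /andP[xA1]; apply/negP; rewrite (disjointFr dis).
- apply/negP=> /imsetP[A GA A0]; case/negP: G0.
  suff -> : set0 = A by [].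
  by apply: inflate_inj => //; rewrite -A0; apply/setP=> p; rewrite !inE.
Qed.

Lemma pblock_inflate G (y0 : Y) p : partition G [set: X] ->
  pblock (inflate @: G) p = inflate (pblock G p.1).
Proof.
move=> partG; have inG x : x \in cover G by rewrite (cover_partition partG) inE.
have /and3P[_ trG' _] := partition_inflate y0 partG.
by apply: def_pblock => //; rewrite ?imset_f ?pblock_mem // inE mem_pblock.
Qed.

Lemma transversal_inflate G (y0 : Y) (S : {set X * Y}) :
    partition G [set: X] ->
  transversal_to (inflate @: G) S <->
    {in S &, injective fst} /\ transversal_to G (fst @: S).
Proof.
move=> partG.
have eqG p q : (pblock (inflate @: G) p = pblock (inflate @: G) q) <->
               (pblock G p.1 = pblock G q.1).
  rewrite !(pblock_inflate y0) //; split=> [|-> //].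
  exact: inflate_inj.
rewrite (transversalP _ (partition_inflate y0 partG)) (transversalP _ partG).
split=> [injS | [injf injS] p q Sp Sq /eqG].
  split=> [p q Sp Sq eqf | _ _ /imsetP[p Sp ->] /imsetP[q Sq ->] /eqG].
    by apply: injS => //; apply/eqG; rewrite eqf.
  by move/(injS p q Sp Sq)->.
by move/injS=> eqf; apply: injf => //; apply: eqf; apply: imset_f.
Qed.

End Inflation.

Lemma card_succ_subset (T : finType) (S b : {set T}) :
  S \subset b -> #|b| = #|S|.+1 -> exists2 x, x \notin S & b = x |: S.
Proof.
move=> Sb cb.
have /cards1P[x def_x] : #|b :\: S| == 1 by rewrite cardsD (setIidPr Sb) cb subSnn.
have: x \in b :\: S by rewrite def_x inE.
rewrite inE => /andP[nSx _]; exists x => //.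
by rewrite -def_x setUC -{1}(setID b S) (setIidPr Sb).
Qed.

(** The hypothesis that blocks have size [t.+1] is what makes a single linear
    condition work: the blocks [b'] over [b] form an orthogonal array of
    strength [t] with [t.+1] columns. *)
Theorem GDD_weighting t m ty h : 0 < h ->
  GDD_exists t t.+1 m ty ->
  GDD_exists t t.+1 (h * m) [seq (h * p.1, p.2) | p <- ty].
Proof.
case: h => // h _ [X [G [B []]]].
move=> t_gt1 def_m cardX partG typeG sizeB trB cov.
pose Y := 'I_h.+1; pose sum2 (b : {set X * Y}) := (\sum_(p in b) p.2)%R.
(* The cardinality condition says that [b] meets each fibre of the projection
   at most once, since [fst @: b] has [t.+1] points as well. *)
pose B' := [set b : {set X * Y} |
  [&& #|b| == t.+1, fst @: b \in B & sum2 b == 0%R]].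
have y0 : Y := ord0.
exists (X * Y)%type, (@inflate X Y @: G), B'; split=> //.
- by rewrite def_m big_map big_distrr; apply: eq_bigr => p _ /=; lia.
- by rewrite card_prod card_ord cardX mulnC.
- exact: partition_inflate.
- have permG : perm_eq (enum (@inflate X Y @: G)) (map (@inflate X Y) (enum G)).
    apply: uniq_perm; rewrite ?enum_uniq ?(map_inj_uniq (inflate_inj y0)) ?enum_uniq //.
    move=> A; rewrite mem_enum; apply/imsetP/mapP => -[A0 GA ->]; exists A0 => //;
      by rewrite mem_enum in GA *.
  apply: perm_trans (perm_map _ permG) _.
  have -> : [seq #|A : {set X * Y}| | A <- map (@inflate X Y) (enum G)] =
            map (muln h.+1) [seq #|A : {set X}| | A <- enum G].
    by rewrite -!map_comp; apply: eq_map => A /=; rewrite card_inflate card_ord.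
  apply: perm_trans (perm_map _ typeG) _.
  rewrite map_flatten -!map_comp.
  by rewrite (eq_map (fun p : nat * nat => map_nseq p.2 (muln h.+1) p.1)).
- by move=> b; rewrite inE => /and3P[/eqP].
- move=> b; rewrite inE => /and3P[/eqP cb Bb _].
  apply/(transversal_inflate y0 _ partG); split; last exact: trB.
  by apply/imset_injP; rewrite (sizeB _ Bb) cb.
move=> S cS /(transversal_inflate y0 _ partG)[injS trS].
have cS1 : #|fst @: S| = t by rewrite card_in_imset.
have [b [[Bb Sb] uniqb]] := cov _ cS1 trS.
have [y nSy def_b] : exists2 y, y \notin fst @: S & b = y |: fst @: S.
  by apply: card_succ_subset => //; rewrite sizeB // cS1.
(* The only level at which [y] can complete [S] to a sum of 0. *)
pose q : X * Y := (y, (- sum2 S)%R).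
have nS z : z \notin fst @: S -> forall v, (z, v) \notin S.
  by move=> nSz v; apply: contra nSz => Sz; apply/imsetP; exists (z, v).
exists (q |: S); split.
  rewrite subsetUr inE cardsU1 nS // cS eqxx imsetU1 -def_b Bb.
  by rewrite /sum2 big_setU1 ?nS //= addNr.
move=> b'; rewrite inE => -[/and3P[/eqP cb' Bb' /eqP sum0] Sb'].
have [[z w] nSq def_b'] : exists2 q, q \notin S & b' = q |: S.
  by apply: card_succ_subset; rewrite ?cS.
have eqb : b = z |: fst @: S.
  rewrite (uniqb (fst @: b')) //; last by split=> //; apply: imsetS.
  by rewrite def_b' imsetU1.
have eqz : z = y.
  have: y \in z |: fst @: S by rewrite -eqb def_b !inE eqxx.
  by rewrite inE (negPf nSy) orbF inE => /eqP.
move: sum0; rewrite def_b' /sum2 big_setU1 //= /q eqz.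
by move/eqP; rewrite addr_eq0 => /eqP->.
Qed.

(** * Designs given by lists *)

Section ListCheck.
Variables (T : eqType) (l : T -> nat).

(** The candidate blocks are filtered each time a point is chosen, so that the
    work along all choices of [t] points stays small enough for evaluation by
    the kernel.  The labels of the chosen points are recorded in [used], and
    only points of fresh label are chosen. *)
Fixpoint each_once t (xs : seq T) (used : seq nat) (bs : seq (seq T)) :=
  if t is t'.+1 then
    if xs is x :: xs' then
      each_once t xs' used bs &&
      ((l x \in used) ||
         each_once t' xs' (l x :: used) [seq b <- bs | x \in b])
    else true
  else size bs == 1.

(** The invariant behind the recursion: [bs] holds the blocks through the points
    already chosen, so that any completion by [t] points of fresh and distinct
    labels singles out one of them. *)
Lemma each_onceP t xs used bs s :
    each_once t xs used bs -> subseq s xs -> size s = t ->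
    uniq (map l s) -> ~~ has (mem used) (map l s) ->
  size [seq b <- bs | all (mem b) s] = 1.
Proof.
elim: xs t used bs s => [|x xs IH] t used bs [|y s] chk //.
- by move=> _ ct; move: chk; rewrite -ct /= filter_predT => /eqP.
- by move=> _ ct; move: chk; rewrite -ct /= filter_predT => /eqP.
move=> /= + ct; case: t ct chk => // t [ct] /= /andP[chk1 chk2].
case: eqP => [-> | _] sub.
  move=> /andP[nls us]; rewrite negb_or => /andP[nlx nused].
  move: chk2; rewrite (negPf nlx) /= => chk2.
  rewrite -(IH _ _ _ _ chk2 sub ct us) -?filter_predI.
    by congr size; apply: eq_filter => b /=; rewrite andbC.
  apply/hasPn=> i si; rewrite inE negb_or (hasPn nused) // andbT.
  by apply: contraNneq nls => <-.
by move=> us nused; apply: (IH t.+1 used bs (y :: s)) => //=; rewrite ct.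
Qed.
End ListCheck.

Definition toset n (s : seq nat) : {set 'I_n} := [set x | val x \in s].

Lemma card_ord_nat n (P : pred nat) :
  #|[set x : 'I_n | P x]| = count P (iota 0 n).
Proof. by rewrite cardsE cardE size_filter -val_enum_ord count_map enumT. Qed.

Lemma card_toset n s : uniq s -> all (gtn n) s -> #|toset n s| = size s.
Proof.
move=> us bs; rewrite card_ord_nat -size_filter; apply/perm_size/uniq_perm => //.
  by rewrite filter_uniq ?iota_uniq.
move=> x; rewrite mem_filter mem_iota /= andb_idr //.
by move=> sx; apply: (allP bs).
Qed.

Lemma uniq_map_inj (T1 T2 : eqType) (f : T1 -> T2) (s : seq T1) :
  uniq (map f s) -> {in s &, injective f}.
Proof.
elim: s => //= x s IH /andP[nfx us] y z; rewrite !inE.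
move=> /predU1P[->|sy] /predU1P[->|sz] eqf //.
- by case/mapP: nfx; exists z.
- by case/mapP: nfx; exists y.
- exact: IH.
Qed.

(** Points are the numbers below [n], groups are the fibres of [l] over the
    numbers below [r], and blocks are listed in [bs]. *)
Section GDDofLists.
Variables (t k n r : nat) (l : nat -> nat) (bs : seq (seq nat)).
Hypothesis l_lt : all (fun x => l x < r) (iota 0 n).
Hypothesis l_onto : all (fun i => has (fun x => l x == i) (iota 0 n)) (iota 0 r).
Hypothesis bs_ok :
  all (fun b => [&& size b == k, all (gtn n) b & uniq (map l b)]) bs.
Hypothesis cover_ok : each_once l t (iota 0 n) [::] bs.

Definition fibre (i : 'I_r) := [set x : 'I_n | l x == i].
Let G := [set fibre i | i : 'I_r].

Lemma fibre_neq0 i : exists x, x \in fibre i.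
Proof.
have /hasP[x] : has (fun x => l x == i) (iota 0 n).
  by apply: (allP l_onto); rewrite mem_iota ltn_ord.
by rewrite mem_iota => lt_x lx; exists (Ordinal lt_x); rewrite inE.
Qed.

Lemma fibre_inj : injective fibre.
Proof.
move=> i j eqF; have [x Fi] := fibre_neq0 i.
by move: (Fi); rewrite eqF; move: Fi; rewrite !inE => /eqP-> /eqP/val_inj.
Qed.

Lemma partition_fibre : partition G [set: 'I_n].
Proof.
apply/and3P; split.
- rewrite eqEsubset subsetT; apply/subsetP=> x _.
  have lx : l x < r by apply: (allP l_lt); rewrite mem_iota /=.
  by apply/bigcupP; exists (fibre (Ordinal lx)); rewrite ?imset_f // inE.
- apply/trivIsetP=> _ _ /imsetP[i _ ->] /imsetP[j _ ->] neqF.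
  rewrite -setI_eq0; apply: contraNT neqF => /set0Pn[x].
  by rewrite !inE => /andP[/eqP-> /eqP /val_inj->].
- by apply/imsetP=> -[i _ F0]; have [x] := fibre_neq0 i; rewrite -F0 inE.
Qed.

Lemma transversal_fibre (S : {set 'I_n}) :
  transversal_to G S <-> {in S &, injective (fun x : 'I_n => l x)}.
Proof.
split=> [trS x y Sx Sy eql | injS A /imsetP[i _ ->]].
  have lx : l x < r by apply: (allP l_lt); rewrite mem_iota /=.
  have /trS/card_le1_eqP : fibre (Ordinal lx) \in G by apply: imset_f.
  by apply; rewrite !inE ?Sx ?Sy //= eql.
apply/card_le1_eqP=> x y; rewrite !inE => /andP[Sx /eqP lx] /andP[Sy /eqP ly].
by apply: injS => //; rewrite lx.
Qed.

Lemma GDD_of_lists (ty : seq (nat * nat)) :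
    2 <= t ->
    n = \sum_(p <- ty) p.2 * p.1 ->
    perm_eq [seq count (fun x => l x == i) (iota 0 n) | i <- iota 0 r]
            (flatten [seq nseq p.2 p.1 | p <- ty]) ->
  GDD_exists t k n ty.
Proof.
move=> t_gt1 def_n type_ok.
pose B := [set:: map (toset n) bs].
have memB b : b \in B -> exists2 s, s \in bs & b = toset n s.
  by rewrite inE => /mapP.
exists 'I_n, G, B; split=> //.
- exact: card_ord.
- exact: partition_fibre.
- have permG : perm_eq (enum G) (map fibre (enum 'I_r)).
    apply: uniq_perm; rewrite ?enum_uniq ?(map_inj_uniq fibre_inj) ?enum_uniq //.
    move=> A; rewrite mem_enum.
    by apply/imsetP/mapP => -[i _ ->]; exists i; rewrite ?mem_enum.
  apply: perm_trans (perm_map _ permG) _.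
  suff <- : [seq count (fun x => l x == i) (iota 0 n) | i <- iota 0 r] =
            [seq #|A : {set 'I_n}| | A <- map fibre (enum 'I_r)] by [].
  rewrite -(val_enum_ord r) -!map_comp; apply: eq_map => i /=.
  exact: esym (card_ord_nat n (fun x => l x == i)).
- move=> _ /memB[s bs_s ->].
  have /and3P[/eqP <- lt_s us] := allP bs_ok _ bs_s.
  by apply: card_toset => //; apply: map_uniq us.
- move=> _ /memB[s bs_s ->].
  have /and3P[_ lt_s us] := allP bs_ok _ bs_s.
  apply/transversal_fibre => x y; rewrite !inE => sx sy eql.
  by apply/val_inj; apply: (uniq_map_inj us).
move=> S cS /transversal_fibre injS.
pose s := map val (enum S).
have : size [seq b <- bs | all (mem b) s] = 1.
  apply: each_onceP cover_ok _ _ _ _.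
  - rewrite -val_enum_ord; apply: map_subseq.
    by rewrite enumT; apply: filter_subseq.
  - by rewrite size_map -cardE.
  - rewrite -map_comp map_inj_in_uniq ?enum_uniq // => x y.
    by rewrite !mem_enum; apply: injS.
  - by apply/hasPn.
have memS b : all (mem b) s = (S \subset toset n b).
  apply/allP/subsetP => [sb x Sx | Sb _ /mapP[x + ->]].
    by rewrite inE; apply/sb/map_f; rewrite mem_enum.
  by rewrite mem_enum => /Sb; rewrite inE.
case def_f: [seq b <- bs | all (mem b) s] => [|b []] // _.
have memf c : c \in bs -> S \subset toset n c -> c = b.
  by move=> bs_c Sc; apply/eqP; rewrite -mem_seq1 -def_f mem_filter memS Sc.
have : b \in [seq b <- bs | all (mem b) s] by rewrite def_f mem_head.
rewrite mem_filter memS => /andP[Sb bs_b].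
exists (toset n b); split; first by rewrite inE map_f.
by move=> _ [/memB[c bs_c ->] Sc]; rewrite (memf c).
Qed.
End GDDofLists.

(** * A design of type 2^7 8^1 *)

(** The points [2 * i] and [(2 * i).+1] form the group [i] of Z_7, and the points
    from 14 on form the large group.  These quadruples, two over each of the
    five orbits of Z_7 on its 4-subsets, are completed to blocks by 14. *)
Definition block_orbit_reps : seq (seq nat) :=
  [:: [:: 0; 2; 5; 7];
      [:: 0; 3; 4; 7];
      [:: 1; 2; 4; 8];
      [:: 1; 3; 5; 9];
      [:: 0; 2; 4; 10];
      [:: 1; 3; 4; 11];
      [:: 0; 3; 6; 9];
      [:: 1; 3; 6; 8];
      [:: 1; 2; 6; 11];
      [:: 1; 2; 7; 10]].

Definition rotate i x := (x + 2 * i) %% 14.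

(** The Fano plane is developed modulo 7 from the line 1, 2, 4, whose complement
    is 0, 3, 5, 6.  Index 0 stands for the zero word of the simplex code, and
    [j.+1] for the complement of the line shifted by [j]. *)
Definition flip i x :=
  if i is j.+1 then
    if (x./2 + 7 - j) %% 7 \in [:: 0; 3; 5; 6]
    then x./2.*2 + ~~ odd x else x
  else x.

Definition blocks22 : seq (seq nat) :=
  [seq rcons (map (flip i) w) (14 + i)
     | w <- [seq map (rotate j) w | w <- block_orbit_reps, j <- iota 0 7],
       i <- iota 0 8].

Definition label22 x := minn x./2 7.

(** The cover condition concerns 2800 transversal quadruples: 560 inside the small
    groups, and 280 triples combined with each point of the large group. *)
Lemma GDD_2_7_8_1 : GDD_exists 4 5 22 [:: (2, 7); (8, 1)].
Proof.
apply: (@GDD_of_lists 4 5 22 8 label22 blocks22).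
- by vm_compute.
- by vm_compute.
- by vm_compute.
- by vm_compute.
- by [].
- by rewrite !big_cons big_nil.
- by vm_compute.
Qed.

(** * The spectrum of type g^7 (4g)^1 *)

(** One of the three fixed points must lie in the large group: what is left then
    has the size [5 * g], whose parity is that of [g]. *)
Lemma GDD_7_1_even g : 0 < g ->
  GDD_exists 4 5 (7 * g + 4 * g) [:: (g, 7); (4 * g, 1)] -> ~~ odd g.
Proof.
move=> g_gt0 [X [G [B gdd]]].
have [_ _ cardX partG typeG _ _ _] := gdd.
have sizes : perm_eq [seq #|A : {set X}| | A <- enum G] (4 * g :: nseq 7 g).
  by apply: perm_trans typeG (permEl (perm_catC (nseq 7 g) [:: 4 * g])).
have /mapP[A] : 4 * g \in [seq #|A : {set X}| | A <- enum G].
  by rewrite (perm_mem sizes) mem_head.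
rewrite mem_enum => GA cA.
have sizes' : perm_eq [seq #|A0 : {set X}| | A0 <- rem A (enum G)] (nseq 7 g).
  rewrite -(perm_cons (4 * g)) (perm_trans _ sizes) // {1}cA.
  by rewrite perm_sym -map_cons; apply/perm_map/perm_to_rem; rewrite mem_enum.
have eqg C : C \in G -> C != A -> #|C| = g.
  move=> GC neC; have : #|C| \in nseq 7 g.
    rewrite -(perm_mem sizes'); apply: map_f.
    by rewrite mem_rem_uniq ?enum_uniq // inE neC mem_enum.
  by rewrite mem_nseq => /eqP.
have : size (rem A (enum G)) = 7.
  by have := perm_size sizes'; rewrite size_map size_nseq.
have := mem_rem_uniq A (enum_uniq G); have := rem_uniq A (enum_uniq G).
case: (rem A (enum G)) => [|C1 [|C2 Cs]] //= uC memC _.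
have [] : (C1 \in G) /\ C1 != A.
  by apply/andP; have := memC C1; rewrite !inE eqxx mem_enum andbC => <-.
move=> GC1 ne1.
have [] : (C2 \in G) /\ C2 != A.
  by apply/andP; have := memC C2; rewrite !inE eqxx orbT mem_enum andbC => <-.
move=> GC2 ne2.
have ne12 : C1 != C2 by move: uC; rewrite inE negb_or => /andP[/andP[]].
have /and3P[/eqP covG trG _] := partG.
have [c1 c2] := (eqg _ GC1 ne1, eqg _ GC2 ne2).
have nonempty C : C \in G -> 0 < #|C| -> exists2 x, x \in C & pblock G x = C.
  by move=> GC /card_gt0P[x Cx]; exists x; rewrite ?(def_pblock trG GC Cx).
have [a Aa pa] : exists2 x, x \in A & pblock G x = A.
  by apply: nonempty; rewrite // -cA muln_gt0.
have [b Cb pb] : exists2 x, x \in C1 & pblock G x = C1.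
  by apply: nonempty; rewrite ?c1.
have [c Cc pc] : exists2 x, x \in C2 & pblock G x = C2.
  by apply: nonempty; rewrite ?c2.
pose S := a |: [set b; c].
have imS : pblock G @: S = A |: [set C1; C2].
  by rewrite /S !imsetU1 imset_set1 pa pb pc.
have cimS : #|pblock G @: S| = 3.
  by rewrite imS cardsU1 cards2 ne12 !inE negb_or eq_sym ne1 eq_sym ne2.
have cS : #|S| = 3.
  apply/eqP; rewrite eqn_leq -{2}cimS leq_imset_card andbT.
  rewrite /S cardsU1 cards2; by case: (a \notin _) (b != c) => [] [].
have trS : transversal_to G S.
  by apply/(transversalP _ partG)/imset_injP; rewrite cimS cS.
have := gdd_dvdn gdd trS; rewrite cS => /(_ erefl).
have subP : pblock G @: S \subset G.
  rewrite imS; apply/subsetP=> C; rewrite !inE.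
  by case/or3P=> /eqP->.
have def_Y : [set y | pblock G y \notin pblock G @: S] =
             ~: cover (pblock G @: S).
  apply/setP=> y; rewrite !inE; congr (~~ _).
  apply/idP/bigcupP=> [Py | [C PC Cy]].
    by exists (pblock G y); rewrite ?mem_pblock ?covG ?inE.
  by rewrite (def_pblock trG (subsetP subP _ PC) Cy).
have cardP : #|cover (pblock G @: S)| = 6 * g.
  rewrite -(eqP (trivIsetS subP trG)) imS big_setU1 ?big_setU1 ?big_set1 /=.
  - by rewrite -cA c1 c2; clear; lia.
  - by rewrite inE.
  - by rewrite !inE negb_or eq_sym ne1 eq_sym ne2.
rewrite def_Y cardsCs setCK cardX cardP.
have -> : 7 * g + 4 * g - 6 * g = g * 5 by clear; lia.
by rewrite Gauss_dvdl // dvdn2.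
Qed.

Theorem corollary6 (g : nat) (g_gt0 : 0 < g) :
  GDD_exists 4 5 (7 * g + 4 * g) [:: (g, 7); (4 * g, 1)] <-> ~~ odd g.
Proof.
split=> [|even_g]; first exact: GDD_7_1_even.
have := @GDD_weighting 4 22 [:: (2, 7); (8, 1)] g./2.
have -> : g./2 * 22 = 7 * g + 4 * g by lia.
rewrite /= (_ : g./2 * 2 = g) 1?(_ : g./2 * 8 = 4 * g); try lia.
by apply; [lia | exact: GDD_2_7_8_1].
Qed.
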